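(* Let $\mathcal{H}$ be a complex Hilbert space, let $A\in\mathcal{B}(\mathcal{H})$ be positive semidefinite, and let $T\in\mathcal{B}_A(\mathcal{H})$. Then $$dw_A^2(T)\le 3\left\|(|T|_A^2)^{\sharp_A}|T|_A^2+|T|_A^2\right\|_A-c_A(|T|_A^2+T)\,m_A(|T|_A^2+T)-c_A(|T|_A^2-T)\,m_A(|T|_A^2-T).$$
   Context: $\mathcal{B}(\mathcal{H})$ is the algebra of bounded linear operators on the complex Hilbert space $\mathcal{H}$. For a positive semidefinite $A\in\mathcal{B}(\mathcal{H})$, put $\langle x,y\rangle_A=\langle Ax,y\rangle$ and $\|x\|_A=\sqrt{\langle x,x\rangle_A}$. $\mathcal{B}_A(\mathcal{H})$ is the set of $T\in\mathcal{B}(\mathcal{H})$ admitting an $A$-adjoint, i.e. such that $AX=T^*A$ has a solution $X\in\mathcal{B}(\mathcal{H})$; then $T^{\sharp_A}$ denotes the unique solution with $\mathcal{R}(T^{\sharp_A})\subseteq\overline{\mathcal{R}(A)}$ ($\mathcal{R}$ denotes range). $\mathcal{B}_A(\mathcal{H})$ is an algebra closed under $\sharp_A$, and every $T\in\mathcal{B}_A(\mathcal{H})$ is $A$-bounded, i.e. $\|Tx\|_A\le c\|x\|_A$ for all $x$ and some $c>0$. Write $|T|_A^2=T^{\sharp_A}T$. For $A$-bounded $T$: $\|T\|_A=\sup\{\|Tx\|_A:\|x\|_A=1\}$, $m_A(T)=\inf\{\|Tx\|_A:\|x\|_A=1\}$, $c_A(T)=\inf\{|\langle Tx,x\rangle_A|:\|x\|_A=1\}$,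 and $dw_A(T)=\sup\{\sqrt{|\langle Tx,x\rangle_A|^2+\|Tx\|_A^4}:\|x\|_A=1\}$, where $x$ ranges over $\mathcal{H}$. $dw_A^2(T)$ means $(dw_A(T))^2$. *)

(* Defs.v *)
From HB Require Import structures.
From mathcomp Require Import all_boot all_order all_algebra.
From mathcomp Require Import sesquilinear complex.
From mathcomp Require Import all_classical all_reals all_analysis.

Set Implicit Arguments.
Unset Strict Implicit.
Unset Printing Implicit Defensive.

Import Order.TTheory GRing.Theory Num.Theory.
Import numFieldNormedType.Exports.

Local Open Scope classical_set_scope.
Local Open Scope ring_scope.

Section SemiHilbert.
Variables (R : realType) (H : completeNormedModType R[i]).

(* [ip] is linear in its first argument and conjugate-linear in the second.
   [hilbert_product ip] says that the norm of the Banach space H is the one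
   induced by [ip], i.e. that (H, ip) is a complex Hilbert space. *)
Variable ip : {dot H for @Num.conj R[i]}.

Definition hilbert_product : Prop := forall x : H, ip x x = `|x| ^+ 2.

Definition bounded_operator : set (H -> H) :=
  [set T | linear T /\ continuous T].

(* The Hilbert space adjoint T^*, which exists by the Riesz theorem. The
   default value 0 is used only if T is not a bounded operator. *)
Definition adjoint (T : H -> H) : H -> H :=
  xget 0 [set S | bounded_operator S /\ forall x y, ip (T x) y = ip x (S y)].

(* In R[i], 0 <= z means that z is real and nonnegative. *)
Definition positive_semidefinite (A : H -> H) : Prop :=
  bounded_operator A /\ forall x, 0 <= ip (A x) x.

Section FixedA.
Variable A : H -> H.

Definition ipA (x y : H) : R[i] := ip (A x) y.

(* [ipA x x] is real and nonnegative when A is positive semidefinite. *)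
Definition normA (x : H) : R := Num.sqrt (complex.Re (ipA x x)).

Definition is_A_adjoint (T X : H -> H) : Prop :=
  bounded_operator X /\ A \o X = adjoint T \o A.

Definition BA : set (H -> H) :=
  [set T | bounded_operator T /\ exists X, is_A_adjoint T X].

(* The default value 0 is used only if T is not in BA. *)
Definition sharpA (T : H -> H) : H -> H :=
  xget 0 [set X | is_A_adjoint T X /\ range X `<=` closure (range A)].

Definition sqabsA (T : H -> H) : H -> H := sharpA T \o T.

Definition sphereA : set H := [set x | normA x = 1].

(* If no vector has A-norm 1 (that is, if A = 0), then the suprema and infima
   below are taken over the empty set, hence equal to 0. *)
Definition opnormA (T : H -> H) : R := sup [set normA (T x) | x in sphereA].

Definition mA (T : H -> H) : R := inf [set normA (T x) | x in sphereA].

Definition cA (T : H -> H) : R :=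
  inf [set ComplexField.Normc.normc (ipA (T x) x) | x in sphereA].

Definition dwA (T : H -> H) : R :=
  sup [set Num.sqrt (ComplexField.Normc.normc (ipA (T x) x) ^+ 2
                     + normA (T x) ^+ 4) | x in sphereA].

End FixedA.
End SemiHilbert.

(* Main.v *)
(* On the unit sphere of the A-seminorm put a = <Wx,x>_A = |Tx|_A^2 and
   b = <Tx,x>_A. The parallelogram law for (a, b) in C and for (Wx, Tx) in H
   gives a^2 + |b|^2 = (|a+b|^2 + |a-b|^2) / 2 and
   |(W+T)x|_A^2 + |(W-T)x|_A^2 = 2 <(W^# W + W)x, x>_A, and Cauchy-Schwarz
   gives |a+b| <= |(W+T)x|_A, hence c_A(W+T) m_A(W+T) <= |(W+T)x|_A^2;
   likewise for W - T. The analysis behind this is the existence of T^* (Riesz)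
   and of T^# (orthogonal projection onto the closure of the range of A), and
   the finiteness of the supremum defining |W^# W + W|_A, without which [sup]
   would return 0. *)
Require Import Defs.
From HB Require Import structures.
From mathcomp Require Import all_boot all_order all_algebra.
From mathcomp Require Import sesquilinear complex.
From mathcomp Require Import all_classical all_reals all_analysis.
From mathcomp Require Import ring lra.

Import Order.TTheory GRing.Theory Num.Theory.
Import numFieldNormedType.Exports.

Local Open Scope classical_set_scope.
Local Open Scope ring_scope.

Set Implicit Arguments.
Unset Strict Implicit.
Unset Printing Implicit Defensive.

Local Notation normc := ComplexField.Normc.normc.

(** * Moduli in R[i] and Bernoulli's inequality *)

Section Scalars.
Variable R : realType.
Implicit Types (a b : R[i]) (r : R).

Lemma normc_sqr a : normc a ^+ 2 =
  complex.Re a ^+ 2 + complex.Im a ^+ 2.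
Proof. by case: a => u v /=; rewrite sqr_sqrtr // addr_ge0 ?sqr_ge0. Qed.

Lemma normc_ge0 (a : R[i]) : 0 <= normc a.
Proof. by case: a => u v /=; exact: sqrtr_ge0. Qed.

Lemma normc_parallelogram a b :
  normc (a + b) ^+ 2 + normc (a - b) ^+ 2 =
  2 * normc a ^+ 2 + 2 * normc b ^+ 2.
Proof. by rewrite !normc_sqr; case: a => a1 a2; case: b => b1 b2 /=; ring. Qed.

(** Powers of a ratio above 1 are thereby unbounded, which closes the growth argument for
    A-self-adjoint operators. *)
Lemma bernoulli r n : 1 <= r -> 1 + n%:R * (r - 1) <= r ^+ n.
Proof.
move=> r1; elim: n => [|n IH]; first by rewrite mul0r addr0 expr0.
rewrite exprS -natr1; apply: (@le_trans _ _ (r * (1 + n%:R * (r - 1)))).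
  have : 0 <= n%:R * (r - 1) * (r - 1) :> R by rewrite !mulr_ge0 // subr_ge0.
  lra.
by rewrite ler_wpM2l // (le_trans ler01).
Qed.
End Scalars.

(** * Complex semi-inner products *)

Section PsdForm.
Variables (R : realType) (V : lmodType R[i]).
Implicit Types (x y z : V) (r : R) (a : R[i]).

(** Definiteness is left out so that the inner product of [H] and the possibly degenerate form [ipA]
    share one theory. *)
Record psd_form (h : V -> V -> R[i]) : Prop := PsdForm {
  psdDl : forall x y z, h (x + y) z = h x z + h y z;
  psdZl : forall a x y, h (a *: x) y = a * h x y;
  psdC : forall x y, h y x = conjc (h x y);
  psd_ge0 : forall x, 0 <= h x x }.

Variable h : V -> V -> R[i].
Hypothesis hP : psd_form h.

Definition rform x y : R := complex.Re (h x y).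
Definition seminorm x : R := Num.sqrt (rform x x).

Lemma rformC x y : rform y x = rform x y.
Proof. by rewrite /rform (psdC hP x y); case: (h x y). Qed.

Lemma rformDl x y z : rform (x + y) z = rform x z + rform y z.
Proof. by rewrite /rform (psdDl hP); case: (h x z); case: (h y z). Qed.

Lemma rformZl r x y : rform (r%:C%C *: x) y = r * rform x y.
Proof. by rewrite /rform (psdZl hP); case: (h x y) => u v /=; ring. Qed.

Lemma rformNl x y : rform (- x) y = - rform x y.
Proof.
by rewrite -scaleN1r -[-1](rmorphN1 (real_complex R)) rformZl mulN1r.
Qed.

Lemma rformDr x y z : rform x (y + z) = rform x y + rform x z.
Proof. by rewrite rformC rformDl !(rformC _ x). Qed.

Lemma rformZr r x y : rform x (r%:C%C *: y) = r * rform x y.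
Proof. by rewrite rformC rformZl rformC. Qed.

Lemma rformNr x y : rform x (- y) = - rform x y.
Proof. by rewrite rformC rformNl rformC. Qed.

Lemma rform_ge0 x : 0 <= rform x x.
Proof. by have := psd_ge0 hP x; rewrite lecE => /andP[]. Qed.

Lemma psd_real x : h x x = (rform x x)%:C%C.
Proof. by rewrite /rform RRe_real // ger0_real // psd_ge0. Qed.

Lemma psdNl x y : h (- x) y = - h x y.
Proof. by rewrite -scaleN1r (psdZl hP) mulN1r. Qed.

Lemma psdBl x y z : h (x - y) z = h x z - h y z.
Proof. by rewrite (psdDl hP) psdNl. Qed.

Lemma psdZr a x y : h x (a *: y) = conjc a * h x y.
Proof. by rewrite (psdC hP (a *: y)) (psdZl hP) rmorphM (psdC hP y). Qed.

Lemma psdDr x y z : h x (y + z) = h x y + h x z.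
Proof.
by rewrite (psdC hP (y + z)) (psdDl hP) rmorphD (psdC hP y) (psdC hP z).
Qed.

Lemma psdBr x y z : h x (y - z) = h x y - h x z.
Proof. by rewrite psdDr -scaleN1r psdZr rmorphN1 mulN1r. Qed.

Lemma seminorm_ge0 x : 0 <= seminorm x.
Proof. exact: sqrtr_ge0. Qed.

Lemma sqr_seminorm x : seminorm x ^+ 2 = rform x x.
Proof. by rewrite sqr_sqrtr // rform_ge0. Qed.

Lemma rformD x y :
  rform (x + y) (x + y) = rform x x + 2 * rform x y + rform y y.
Proof. by rewrite rformDl !rformDr (rformC x y); ring. Qed.

Lemma rformB x y :
  rform (x - y) (x - y) = rform x x - 2 * rform x y + rform y y.
Proof. by rewrite rformD rformNr rformNl rformNr; ring. Qed.

Lemma parallelogram x y :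
  rform (x + y) (x + y) + rform (x - y) (x - y) =
    2 * rform x x + 2 * rform y y.
Proof. by rewrite rformD rformB; ring. Qed.

(** The form is nonnegative at s x + t y for all real s, t. Write a, b, c for its values at (x, x),
    (y, y), (x, y). The choice (c, -a) gives a (ab - c^2) >= 0; if a = 0, the choice (-(b + 1), c)
    gives -(b + 2) c^2 >= 0, so c = 0. *)
Lemma rform_CS_sqr x y : rform x y ^+ 2 <= rform x x * rform y y.
Proof.
have p s t :
    0 <= s ^+ 2 * rform x x + 2 * (s * t) * rform x y + t ^+ 2 * rform y y.
  have := rform_ge0 (s%:C%C *: x + t%:C%C *: y).
  by rewrite rformD !rformZl !rformZr; congr (0 <= _); ring.
have hx := rform_ge0 x; have hy := rform_ge0 y.
move: p hx hy; move: (rform x x) (rform y y) (rform x y) => a b c p a0 b0.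
have [a_eq0|a_neq0] := eqVneq a 0.
  have := p (- (b + 1)) c; rewrite a_eq0; nra.
have := p c (- a); have {}a0 : 0 < a by rewrite lt_def a_neq0.
rewrite (_ : _ + _ = a * (a * b - c ^+ 2)); last by ring.
by rewrite pmulr_rge0 // subr_ge0.
Qed.

Lemma rform_CS x y : `|rform x y| <= seminorm x * seminorm y.
Proof.
rewrite -ler_sqr ?nnegrE ?mulr_ge0 ?seminorm_ge0 //.
by rewrite exprMn !sqr_seminorm real_normK ?num_real // rform_CS_sqr.
Qed.

(* Multiplying [x] by the conjugate of [h x y] makes the form real. *)
Lemma psd_CS_sqr x y :
  normc (h x y) ^+ 2 <= rform x x * rform y y.
Proof.
have := rform_CS_sqr (conjc (h x y) *: x) y.
have -> : rform (conjc (h x y) *: x) y = normc (h x y) ^+ 2.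
  by rewrite normc_sqr {1}/rform (psdZl hP); case: (h x y) => u v /=; ring.
have -> : rform (conjc (h x y) *: x) (conjc (h x y) *: x) =
    normc (h x y) ^+ 2 * rform x x.
  rewrite normc_sqr {1}/rform (psdZl hP) (psdC hP (conjc _ *: _)) (psdZl hP).
  by rewrite psd_real; case: (h x y) => u v /=; ring.
move: (sqr_ge0 (normc (h x y))) (rform_ge0 x) (rform_ge0 y).
move: (normc (h x y) ^+ 2) => n; rewrite le_eqVlt => /orP[/eqP<- | n0] hx hy.
  by move=> _; rewrite mulr_ge0.
by rewrite expr2 -mulrA ler_pM2l.
Qed.

Lemma psd_CS x y :
  normc (h x y) <= seminorm x * seminorm y.
Proof.
rewrite -ler_sqr ?nnegrE ?normc_ge0 ?mulr_ge0 ?seminorm_ge0 //.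
by rewrite exprMn !sqr_seminorm psd_CS_sqr.
Qed.

Lemma seminormN x : seminorm (- x) = seminorm x.
Proof. by rewrite /seminorm rformNl rformNr opprK. Qed.
End PsdForm.

(** * Norm, continuity and completeness of [H] through a real-valued norm *)

Section Hilbert.
Variables (R : realType) (H : completeNormedModType R[i]).
Variable ip : {dot H for @Num.conj R[i]}.
Hypothesis hH : hilbert_product ip.
Implicit Types (x y z : H) (T : H -> H) (M : set H).

Lemma dot_psd_form : psd_form ip.
Proof.
split=> [x y z|a x y|x y|x].
- exact: linearDl.
- exact: linearZl_LR.
- by rewrite hermC expr0 mul1r.
- have [->|x0] := eqVneq x 0; first by rewrite linear0l.
  exact/ltW/neq0_dnorm_gt0.
Qed.
Let ipP := dot_psd_form.

(** The norm of [H] takes its values in R[i]; this bridge lets the estimates be made in [R]. *)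
Lemma norm_seminorm x : `|x| = (seminorm ip x)%:C%C.
Proof.
apply/eqP; rewrite -(@eqrXn2 _ 2) ?normr_ge0 //; last first.
  by rewrite ler0c seminorm_ge0.
by rewrite -hH (psd_real ipP) -rmorphXn /= sqr_seminorm.
Qed.

Lemma seminorm_eq0 x : seminorm ip x = 0 -> x = 0.
Proof. by move=> x0; apply/eqP; rewrite -normr_eq0 norm_seminorm x0. Qed.

Lemma bounded_operatorP T : bounded_operator T <->
  linear T /\
  exists2 K, 0 < K & forall x, seminorm ip (T x) <= K * seminorm ip x.
Proof.
have pack (Tlin : linear T) : exists f : {linear H -> H}, T = f.
  pose f : {linear H -> H} := HB.pack T (GRing.isLinear.Build _ _ _ _ T Tlin).
  by exists f.
split=> -[Tlin cT]; split=> //; have [f Tf] := pack Tlin; subst T.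
  have /linear_boundedP/pinfty_ex_gt0[r r0 rP] :=
    (linear_bounded_continuous f).2 cT.
  exists (complex.Re r); first by move: r0; rewrite ltcE => /andP[].
  move=> x; rewrite -lecR rmorphM /= -!norm_seminorm RRe_real //.
  exact: gtr0_real.
case: cT => K K0 KP; apply/(linear_bounded_continuous f)/linear_boundedP.
near=> r => x; apply: (@le_trans _ _ (K%:C%C * `|x|)).
  by rewrite !norm_seminorm -rmorphM lecR.
rewrite ler_wpM2r //; near: r; apply: nbhs_pinfty_ge.
by rewrite complex_real.
Unshelve. all: by end_near. Qed.

Lemma closureP M z :
  closure M z <->
  forall e : R, 0 < e -> exists2 m, M m & seminorm ip (z - m) < e.
Proof.
split=> [Mz e e0|Mz B /nbhs_normP[e /= e0 eB]].
  have [|m [Mm]] := Mz (ball z e%:C%C).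
    by apply: nbhsx_ballx; rewrite ltcR.
  by rewrite -ball_normE /= norm_seminorm ltcR; exists m.
have er : (complex.Re e)%:C%C = e by rewrite RRe_real // gtr0_real.
have [|m Mm mz] := Mz (complex.Re e); first by rewrite -ltcR er.
by exists m; split=> //; apply: eB; rewrite /= norm_seminorm -er ltcR.
Qed.

(** Completeness of [H] enters here, in the epsilon form that the minimising sequence of the Riesz
    argument calls for. *)
Lemma seminorm_cauchy_cvg (u : nat -> H) :
  (forall e : R, 0 < e -> exists N : nat, forall m n,
    (N <= m)%N -> (N <= n)%N -> seminorm ip (u m - u n) < e) ->
  exists l, forall e : R, 0 < e ->
    exists N : nat, forall n, (N <= n)%N -> seminorm ip (l - u n) < e.
Proof.
move=> uC; have : cvg (u @ \oo).
  apply: cauchy_cvg; apply: cauchy_exP => e e0.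
  have er : (complex.Re e)%:C%C = e by rewrite RRe_real // gtr0_real.
  have [|N NP] := uC (complex.Re e); first by rewrite -ltcR er.
  exists (u N); exists N => // n /= Nn.
  by rewrite -ball_normE /= norm_seminorm -er ltcR NP.
move=> ul; exists (lim (u @ \oo)) => e e0.
have e0' : 0 < e%:C%C by rewrite ltcR.
have [N _ NP] := (cvgrPdist_lt _ _).1 ul _ e0'.
by exists N => n /NP; rewrite norm_seminorm ltcR.
Qed.

(** * Riesz representation, adjoints and orthogonal projections *)

(* The minimiser of |x|^2 - 2 Re (f x) over the closure of M represents f:
   the parallelogram identity makes every minimising sequence Cauchy. *)
Lemma riesz M (f : H -> R[i]) (K : R) :
  M 0 -> (forall x y, M x -> M y -> M (x + y)) ->
  (forall a x, M x -> M (a *: x)) ->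
  (forall x y, f (x + y) = f x + f y) -> (forall a x, f (a *: x) = a * f x) ->
  (forall x, normc (f x) <= K * seminorm ip x) ->
  exists2 z, closure M z & forall x, M x -> f x = ip x z.
Proof.
move=> M0 MD MZ fD fZ fK.
pose g x := complex.Re (f x); pose q x := rform ip x x - 2 * g x.
have gD x y : g (x + y) = g x + g y.
  by rewrite /g fD; case: (f x) => ? ?; case: (f y).
have gZ r x : g (r%:C%C *: x) = r * g x.
  by rewrite /g fZ; case: (f x) => ? ? /=; rewrite mul0r subr0.
have gK x : g x <= K * seminorm ip x.
  apply: le_trans (fK x); apply: (le_trans (ler_norm _)).
  by rewrite -lecR; exact: normc_ge_Re.
have q_inf : has_inf (q @` M).
  split; first by exists (q 0), 0.
  (* q x >= |x|^2 - 2 K |x| = (|x| - K)^2 - K^2. *)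
  exists (- K ^+ 2) => _ [x _ <-]; rewrite /q -sqr_seminorm //.
  by have := gK x; have := sqr_ge0 (seminorm ip x - K); nra.
pose d := inf (q @` M).
have dq x : M x -> d <= q x by move=> Mx; apply: ge_inf; [case: q_inf|exists x].
have /choice[u uP] (n : nat) : exists x, M x /\ q x < d + n.+1%:R^-1.
  have [|_ [x Mx <-] xd] := @inf_adherent _ (q @` M) n.+1%:R^-1 _ q_inf.
    by rewrite invr_gt0.
  by exists x.
have small (e : R) : 0 < e ->
    exists N : nat, forall n, (N <= n)%N -> n.+1%:R^-1 < e.
  move=> e0; have [N _ NP] := near_infty_natSinv_lt (PosNum e0).
  by exists N => n /NP.
(* The parallelogram identity; the linear terms of [q] cancel. *)
have half_sum x y : rform ip (x - y) (x - y) =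
    2 * q x + 2 * q y - 4 * q ((2^-1)%:C%C *: (x + y)).
  by rewrite /q rformB // rformZl // rformZr // rformD // gZ gD; field.
have [e e0|l lP] := seminorm_cauchy_cvg (u := u).
  (* Two values of [q] below d + e^2 / 4 and a midpoint value of at least d leave less than e^2 in
     [half_sum]. *)
  have [|N NP] := small (e ^+ 2 / 4); first by rewrite divr_gt0 ?exprn_gt0.
  exists N => m n Nm Nn; rewrite -ltr_sqr ?nnegrE ?seminorm_ge0 ?ltW //.
  rewrite sqr_seminorm // half_sum.
  have := dq _ (MZ (2^-1)%:C%C _ (MD _ _ (uP m).1 (uP n).1)).
  have := NP m Nm; have := NP n Nn; have := (uP m).2; have := (uP n).2.
  by move: (e ^+ 2) _.+1%:R^-1 _.+1%:R^-1 => E i j; lra.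
have near_l (e : R) : 0 < e ->
    exists x, [/\ M x, q x < d + e & seminorm ip (l - x) < e].
  move=> e0; have [N1 NP1] := small e e0; have [N2 NP2] := lP e e0.
  exists (u (maxn N1 N2)); split; first by case: (uP (maxn N1 N2)).
    by rewrite (lt_trans (uP _).2) // ltrD2l NP1 // leq_maxl.
  by rewrite NP2 // leq_maxr.
exists l.
  by apply/closureP => e /near_l[x [Mx _ xl]]; exists x.
have gl x : M x -> g x = rform ip x l.
  move=> Mx; set b := rform ip x x; have b0 : 0 <= b by exact: rform_ge0.
  (* First variation at the minimiser: moving from [l] along t x cannot lower [q]. As [l] lies only
     in the closure of [M], it is approximated by points y of [M]. *)
  have tP t : 0 <= 2 * t * (rform ip x l - g x) + t ^+ 2 * b.
    apply/ler_addgt0Pl => e e0.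
    (* Scaled so that the error e / s in q y and the error 2 |t| |x| e / s in the cross term add up
       to e. *)
    set s := 1 + 2 * `|t| * seminorm ip x.
    have s0 : 0 < s by rewrite ltr_wpDr // !mulr_ge0 ?seminorm_ge0.
    have [|y [My yd yl]] := near_l (e / s); first by rewrite divr_gt0.
    have := dq _ (MD _ _ My (MZ t%:C%C _ Mx)).
    rewrite /q rformD // rformZl // !rformZr // gD gZ -/b (rformC ipP x y).
    have ryl : t * (rform ip x y - rform ip x l) <=
        `|t| * (seminorm ip x * (e / s)).
      apply: (le_trans (ler_norm _)); rewrite normrM ler_wpM2l //.
      rewrite -(rformNr ipP) -rformDr //.
      apply: (le_trans (rform_CS ipP _ _)).
      by rewrite ler_wpM2l ?seminorm_ge0 // -(seminormN ipP) opprB ltW.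
    have es : e = e / s + 2 * (`|t| * (seminorm ip x * (e / s))).
      by rewrite /s; field; rewrite -/s gt_eqF.
    move: yd; rewrite /q => yd; move: es ryl yd.
    move: (e / s) => v.
    by move: (`|t| * (seminorm ip x * v)) => w es ryl yd; lra.
  set c := rform ip x l - g x in tP *.
  (* A near-optimal t; b + 1 in place of b keeps the denominator nonzero when b = 0. *)
  have := tP (- c / (b + 1)); suff c0 : 0 <= - (b + 2) * c ^+ 2 -> c = 0.
    rewrite (_ : _ + _ = - (b + 2) * c ^+ 2 / (b + 1) ^+ 2); last first.
      by field; rewrite gt_eqF // ltr_wpDl.
    rewrite pmulr_lge0 ?invr_gt0 ?exprn_gt0 ?ltr_wpDl //.
    by move=> /c0 /eqP; rewrite subr_eq0 => /eqP.
  rewrite mulNr oppr_ge0 pmulr_rle0 ?ltr_wpDl // => c2.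
  by apply/eqP; rewrite -sqrf_eq0 eq_le c2 sqr_ge0.
(* So far the real parts agree; the same identity at i x yields the imaginary parts. *)
move=> x Mx; have := gl _ (MZ 'i%C _ Mx); have := gl _ Mx.
rewrite /g /rform fZ (psdZl ipP).
case: (f x) => a b; case: (ip x l) => a' b' /=.
by rewrite !mul0r !mul1r !sub0r => -> /oppr_inj ->.
Qed.

Lemma ip_ext y z : (forall x, ip x y = ip x z) -> y = z.
Proof.
move=> yz; apply/eqP; rewrite -subr_eq0; apply/eqP/seminorm_eq0.
by apply/eqP; rewrite -sqrf_eq0 sqr_seminorm // /rform (psdBr ipP) yz subrr.
Qed.

Lemma linear_op T : linear T -> [/\ T 0 = 0,
  forall x y, T (x + y) = T x + T y & forall a x, T (a *: x) = a *: T x].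
Proof.
move=> Tlin; have TD x y : T (x + y) = T x + T y.
  by have := Tlin 1 x y; rewrite !scale1r.
have T0 : T 0 = 0 by apply: (addrI (T 0)); rewrite -TD !addr0.
by split=> // a x; have := Tlin a x 0; rewrite T0 !addr0.
Qed.

(** Riesz on the whole space represents x |-> <T x, y> by S y. The bound on S follows from |S y|^2 =
    <T (S y), y> <= K |S y| |y|. *)
Lemma adjoint_exists T : bounded_operator T ->
  exists S, bounded_operator S /\ forall x y, ip (T x) y = ip x (S y).
Proof.
move=> /bounded_operatorP[Tlin [K K0 TK]].
have [_ TD TZ] := linear_op Tlin.
have /choice[S SP] y : exists z, forall x, ip (T x) y = ip x z.
  have [//|//|//|x z|a x|x|z _ zP] :=
    @riesz setT (fun x => ip (T x) y) (K * seminorm ip y).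
  - by rewrite TD (psdDl ipP).
  - by rewrite TZ (psdZl ipP).
  - apply: (le_trans (psd_CS ipP _ _)).
    by rewrite mulrAC ler_wpM2r ?seminorm_ge0.
  by exists z => x; exact: zP.
exists S; split=> //; apply/bounded_operatorP; split.
  move=> a x y; apply: ip_ext => z.
  by rewrite psdDr // psdZr // -!SP psdDr // psdZr.
exists K => // y; have [/seminorm_eq0 ->|Sy0] := eqVneq (seminorm ip (S y)) 0.
  rewrite {1}/seminorm -[0](scale0r 0) (rformZl ipP 0) mul0r sqrtr0.
  by rewrite mulr_ge0 ?seminorm_ge0 // ltW.
have Sy1 : 0 < seminorm ip (S y) by rewrite lt_def Sy0 seminorm_ge0.
rewrite -(ler_pM2l Sy1) -expr2 sqr_seminorm // /rform -SP.
apply: (le_trans (ler_norm _)); apply: (le_trans (rform_CS ipP _ _)).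
by rewrite mulrA [_ * K]mulrC ler_wpM2r ?seminorm_ge0.
Qed.

Lemma adjointP T : bounded_operator T -> bounded_operator (adjoint ip T) /\
  forall x y, ip (T x) y = ip x (adjoint ip T y).
Proof.
move=> /adjoint_exists[S SP]; rewrite /adjoint.
apply: (@xgetPex _ 0 [set S | bounded_operator S /\
  forall x y, ip (T x) y = ip x (S y)]).
by exists S.
Qed.

Lemma closure_orth M y z :
  (forall m, M m -> ip m z = 0) -> closure M y -> ip y z = 0.
Proof.
move=> Mz /closureP My; apply/eqP; rewrite -normr_eq0.
suff : normc (ip y z) <= 0.
  by move=> n0; rewrite eq_le normr_ge0 andbT lecR.
apply/ler_addgt0Pl => e e0; rewrite addr0.
have s0 : 0 < 1 + seminorm ip z by rewrite ltr_wpDr // seminorm_ge0.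
have [|m Mm my] := My (e / (1 + seminorm ip z)); first by rewrite divr_gt0.
rewrite (_ : ip y z = ip (y - m) z); last first.
  by rewrite (psdBl ipP) (Mz _ Mm) subr0.
apply: (le_trans (psd_CS ipP _ _)).
apply: (@le_trans _ _ (e / (1 + seminorm ip z) * (1 + seminorm ip z))).
  by rewrite ler_pM ?seminorm_ge0 ?lerDr // ltW.
by rewrite divfK // gt_eqF.
Qed.

(** P y is the Riesz representative of <., y> on [M], so y - P y is orthogonal to [M], and by
    continuity to its closure. *)
Lemma projection_exists M : M 0 -> (forall x y, M x -> M y -> M (x + y)) ->
  (forall a x, M x -> M (a *: x)) ->
  exists P, [/\ bounded_operator P, range P `<=` closure M &
    forall m x, M m -> ip m (P x) = ip m x].
Proof.
move=> M0 MD MZ.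
have /choice[P PP] y :
    exists z, closure M z /\ forall m, M m -> ip m z = ip m y.
  have [||x|z zM zP] := @riesz M (fun x => ip x y) (seminorm ip y) M0 MD MZ.
  - by move=> x z; exact: (psdDl ipP).
  - by move=> a x; exact: (psdZl ipP).
  - by rewrite mulrC psd_CS.
  by exists z; split=> // m Mm; rewrite zP.
exists P; split; last 2 first.
- by move=> _ [x _ <-]; exact: (PP x).1.
- by move=> m x; exact: (PP x).2.
have orth x z : closure M z -> ip z (P x) = ip z x.
  move=> Mz; apply/eqP; rewrite -subr_eq0 -(psdBr ipP); apply/eqP.
  apply: (closure_orth _ Mz) => m Mm.
  by rewrite (psdBr ipP) (PP x).2 // subrr.
apply/bounded_operatorP; split.
  (* The difference d - e is orthogonal to the closure of [M], which contains d and both P x and P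
     y; expanding e shows that d - e is orthogonal to itself. *)
  move=> a x y; set d := P (a *: x + y).
  pose e := a *: P x + P y.
  have de z : closure M z -> ip z (d - e) = 0.
    move=> Mz; rewrite /d /e !(psdBr ipP, psdDr ipP, psdZr ipP) !orth //.
    by rewrite !(psdDr ipP, psdZr ipP) subrr.
  have dM z : closure M (P z) by exact: (PP z).1.
  apply/eqP; rewrite -subr_eq0; apply/eqP/seminorm_eq0/eqP.
  rewrite -sqrf_eq0 sqr_seminorm // /rform -/e (psdBl ipP) de; last exact: dM.
  by rewrite sub0r {1}/e (psdDl ipP) (psdZl ipP) !de // mulr0 addr0 oppr0.
exists 1 => // x; rewrite mul1r.
have [->|Px0] := eqVneq (seminorm ip (P x)) 0; first exact: seminorm_ge0.
have Px1 : 0 < seminorm ip (P x) by rewrite lt_def Px0 seminorm_ge0.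
rewrite -(ler_pM2l Px1) -expr2 sqr_seminorm // /rform orth.
  exact: (le_trans (ler_norm _) (rform_CS ipP _ _)).
exact: (PP x).1.
Qed.

Lemma bounded_operator_comp S T :
  bounded_operator S -> bounded_operator T -> bounded_operator (S \o T).
Proof.
move=> [Slin cS] [Tlin cT]; split; first by move=> a x y /=; rewrite Tlin Slin.
by move=> x; apply: continuous_comp; [exact: cT|exact: cS].
Qed.

Lemma bounded_operatorD S T :
  bounded_operator S -> bounded_operator T -> bounded_operator (S + T).
Proof.
move=> [Slin cS] [Tlin cT]; split; last first.
  by move=> x; apply: cvgD; [exact: cS|exact: cT].
by move=> a x y; rewrite !fctE Slin Tlin scalerDr addrACA.
Qed.

(** * The A-form and A-adjoints *)

Variable A : H -> H.
Hypothesis hA : positive_semidefinite ip A.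

(** Hermitian symmetry comes by polarisation: <A z, z> is real at z = x + y and at z = x + i y. *)
Lemma ipA_psd_form : psd_form (ipA ip A).
Proof.
have [[Alin cA] A0] := hA; have [_ AD AZ] := linear_op Alin.
have hD x y z : ipA ip A (x + y) z = ipA ip A x z + ipA ip A y z.
  by rewrite /ipA AD (psdDl ipP).
have hZ a x y : ipA ip A (a *: x) y = a * ipA ip A x y.
  by rewrite /ipA AZ (psdZl ipP).
have hDr x y z : ipA ip A x (y + z) = ipA ip A x y + ipA ip A x z.
  exact: (psdDr ipP).
have hZr a x y : ipA ip A x (a *: y) = conjc a * ipA ip A x y.
  exact: (psdZr ipP).
split=> // x y; have im x0 : complex.Im (ipA ip A x0 x0) = 0.
  exact: ger0_Im (A0 x0).
have := im (x + y); rewrite !hD !hDr; have := im (x + 'i%C *: y).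
rewrite !hD !hDr !hZ !hZr; have := im x; have := im y.
case: (ipA ip A x x) => ? ?; case: (ipA ip A y y) => ? ?.
case: (ipA ip A x y) => u v; case: (ipA ip A y x) => u' v' /= -> ->.
by move=> h1 h2; congr Complex; lra.
Qed.
Let ipAP := ipA_psd_form.

(** If X solves A X = T^* A and P projects onto the closure of the range of [A], then A P = A, so P
    X is a solution with the required range. Hence [sharpA] is not the default 0. *)
Lemma sharpAP T : BA ip A T -> bounded_operator (sharpA ip A T) /\
  forall x y, ipA ip A (sharpA ip A T x) y = ipA ip A x (T y).
Proof.
move=> [bT [X [bX AX]]]; have [[Alin _] _] := hA.
have [A0 AD AZ] := linear_op Alin.
have [||a _ [x _ <-]|P [bP Pcl PP]] := @projection_exists (range A).
- by exists 0.
- by move=> _ _ [x _ <-] [y _ <-]; exists (x + y).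
- by exists (a *: x).
have AP x : A (P x) = A x.
  apply: ip_ext => z; rewrite (psdC ipP (A (P x))) (psdC ipP (A x)).
  have AC w : ip (A w) z = conjc (ip (A z) w) by exact: (psdC ipAP).
  by rewrite !AC PP //; exists z.
have [[bS AS] _] : is_A_adjoint ip A T (sharpA ip A T) /\
    range (sharpA ip A T) `<=` closure (range A).
  apply: (@xgetPex _ 0
    [set Y | is_A_adjoint ip A T Y /\ range Y `<=` closure (range A)]).
  exists (P \o X); split; last by move=> _ [x _ <-]; apply: Pcl; exists (X x).
  split; first exact: bounded_operator_comp.
  by rewrite -AX; apply/funext => x /=; rewrite AP.
split=> // x y; have [_ adjT] := adjointP bT.
rewrite /ipA; have /= -> := congr1 (@^~ x) AS.
by rewrite (psdC ipP y) -adjT -(psdC ipP).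
Qed.

(** Here U itself solves A X = U^* A. *)
Lemma BA_selfadjoint U : bounded_operator U ->
  (forall x y, ipA ip A (U x) y = ipA ip A x (U y)) -> BA ip A U.
Proof.
move=> bU sU; split=> //; exists U; split=> //; apply/funext => x /=.
apply: ip_ext => z; have [_ <-] := adjointP bU.
rewrite (psdC ipP (A (U x))) (psdC ipP (A x)); congr conjc; exact: sU.
Qed.

Lemma normA_seminorm x : normA ip A x = seminorm (ipA ip A) x.
Proof. by []. Qed.

(* [normA (U^n x)^2 = <U^(2n) x, x>_A <= normA (U^(2n) x)] on the unit sphere,
   so [normA (U x)^(2^k)] grows at most like the 2^k-th power of the ordinary
   operator norm. *)
Lemma normA_selfadjoint_bounded U : bounded_operator U ->
  (forall x y, ipA ip A (U x) y = ipA ip A x (U y)) ->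
  exists K, forall x, normA ip A x = 1 -> normA ip A (U x) <= K.
Proof.
move=> /bounded_operatorP[_ [K K0 UK]] sU; exists K => x x1.
have [/bounded_operatorP[_ [C C0 AC]] _] := hA.
pose s n := normA ip A (iter n U x).
have s_ge0 n : 0 <= s n by exact: seminorm_ge0.
(* <A y, y> <= C |y|^2 gives normA y <= sqrt C |y|, used at y = U^n x. *)
have sC n : s n <= Num.sqrt C * (K ^+ n * seminorm ip x).
  have : seminorm ip (iter n U x) <= K ^+ n * seminorm ip x.
    elim: n => [|n IH]; first by rewrite mul1r.
    by rewrite exprS -mulrA (le_trans (UK _)) // ler_pM2l.
  move=> /(ler_wpM2l (sqrtr_ge0 C)); apply: le_trans.
  have -> : seminorm ip (iter n U x) = Num.sqrt (seminorm ip (iter n U x) ^+ 2).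
    by rewrite sqrtr_sqr ger0_norm ?seminorm_ge0.
  rewrite -sqrtrM ?(ltW C0) // /s /normA.
  rewrite ler_sqrt ?(mulr_ge0 (ltW C0) (sqr_ge0 _)) //.
  apply: (le_trans (ler_norm _)); apply: (le_trans (rform_CS ipP _ _)).
  by rewrite expr2 mulrA ler_wpM2r ?seminorm_ge0.
have symn n y z : ipA ip A (iter n U y) z = ipA ip A y (iter n U z).
  by elim: n y z => [|n IH] y z //=; rewrite sU IH -iterSr.
have dbl n : s n ^+ 2 <= s (n + n)%N.
  rewrite /s normA_seminorm sqr_seminorm // /rform symn -iterD (psdC ipAP).
  have -> : complex.Re (conjc (ipA ip A (iter (n + n) U x) x)) =
    rform (ipA ip A) (iter (n + n) U x) x.
    by rewrite /rform; case: (ipA _ _ _ _).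
  apply: (le_trans (ler_norm _)); apply: (le_trans (rform_CS ipAP _ _)).
  by rewrite -!normA_seminorm x1 mulr1.
have pow k : s 1%N ^+ (2 ^ k) <= s (2 ^ k)%N.
  elim: k => [|k IH]; first by rewrite expr1.
  rewrite expnS mul2n -addnn; apply: le_trans (dbl _).
  by rewrite exprD -expr2 ler_sqr ?nnegrE ?exprn_ge0.
(* If s 1 > K, then r = s 1 / K exceeds 1 while all powers r^(2^k) stay below a constant D. *)
rewrite leNgt; apply/negP => Ks.
pose r := s 1%N / K; have r1 : 1 < r by rewrite ltr_pdivlMr // mul1r.
pose D := Num.sqrt C * seminorm ip x.
have D0 : 0 <= D by rewrite mulr_ge0 ?seminorm_ge0 ?sqrtr_ge0.
have rD k : r ^+ (2 ^ k) <= D.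
  rewrite expr_div_n ler_pdivrMr ?exprn_gt0 // (le_trans (pow k)) //.
  by rewrite /D mulrAC -mulrA.
have r10 : 0 < r - 1 by rewrite subr_gt0.
(* Choose n with n (r - 1) > D; since 2^n >= n, Bernoulli at exponent 2^n contradicts the bound
   D. *)
have := archi_boundP (divr_ge0 D0 (ltW r10)); set n := Num.bound _.
rewrite ltr_pdivrMr // => Dn.
have := le_trans (bernoulli (2 ^ n) (ltW r1)) (rD n).
have : n%:R * (r - 1) <= (2 ^ n)%:R * (r - 1).
  by rewrite ler_pM2r // ler_nat ltnW // ltn_expl.
lra.
Qed.

(** * Estimates on the A-unit sphere and passage to the supremum *)

Lemma opnormA_ge U x : normA ip A x = 1 ->
  (exists K, forall y, normA ip A y = 1 -> normA ip A (U y) <= K) ->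
  normA ip A (U x) <= opnormA ip A U.
Proof.
move=> x1 [K UK]; apply: ub_le_sup; last by exists x.
by exists K => _ [y y1 <-]; exact: UK.
Qed.

Lemma cA_mA_le U x : normA ip A x = 1 ->
  cA ip A U * mA ip A U <= normA ip A (U x) ^+ 2.
Proof.
move=> x1.
(* Both infima are nonnegative, so their upper bounds at x may be multiplied. *)
have c0 : 0 <= cA ip A U.
  by apply: lb_le_inf; [exists (normc (ipA ip A (U x) x)), x
                       |move=> _ [y _ <-]; exact: normc_ge0].
have m0 : 0 <= mA ip A U.
  by apply: lb_le_inf; [exists (normA ip A (U x)), x
                       |move=> _ [y _ <-]; exact: seminorm_ge0].
have mU : mA ip A U <= normA ip A (U x).
  by apply: ge_inf; [exists 0 => _ [y _ <-]; exact: seminorm_ge0|exists x].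
have cU : cA ip A U <= normA ip A (U x).
  apply: (@le_trans _ _ (normc (ipA ip A (U x) x))).
    by apply: ge_inf; [exists 0 => _ [y _ <-]; exact: normc_ge0|exists x].
  by rewrite (le_trans (psd_CS ipAP _ _)) // -!normA_seminorm x1 mulr1.
by rewrite expr2 ler_pM.
Qed.

(** Let Q = |Wx|_A^2 + |Tx|_A^2. Cauchy-Schwarz and the two parallelogram laws bound the left side
    by Q = 3 Q - 2 Q. Here 2 Q = |(W+T)x|_A^2 + |(W-T)x|_A^2 dominates the two products and Q is at
    most the A-norm, whence the factor 3. *)
Lemma dwA_pointwise T x (W := sqabsA ip A T) : BA ip A T -> normA ip A x = 1 ->
  normc (ipA ip A (T x) x) ^+ 2 + normA ip A (T x) ^+ 4 <=
    3 * opnormA ip A (sharpA ip A W \o W + W)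
    - cA ip A (W + T) * mA ip A (W + T)
    - cA ip A (W - T) * mA ip A (W - T).
Proof.
move=> hT x1; have [bS ST] := sharpAP hT; have bT := hT.1.
have bW : bounded_operator W by exact: bounded_operator_comp.
have WE z y : ipA ip A (W z) y = ipA ip A (T z) (T y) by exact: ST.
(* A-self-adjointness puts W in [BA], so its [sharpA] obeys the adjoint identity; for U below it
   makes the A-norm finite. *)
have sW z y : ipA ip A (W z) y = ipA ip A z (W y).
  by rewrite WE (psdC ipAP (W y)) WE; exact: (psdC ipAP).
have [bV VW] := sharpAP (BA_selfadjoint bW sW).
set U := sharpA ip A W \o W + W.
have UE z y : ipA ip A (U z) y = ipA ip A (W z) (W y) + ipA ip A (W z) y.
  by rewrite /U !fctE (psdDl ipAP) VW.
have bU : bounded_operator U.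
  by apply: bounded_operatorD => //; exact: bounded_operator_comp.
have sU z y : ipA ip A (U z) y = ipA ip A z (U y).
  rewrite (psdC ipAP (U y)) !UE rmorphD; congr (_ + _).
    exact: (psdC ipAP).
  by rewrite sW; exact: (psdC ipAP).
have Ubnd := normA_selfadjoint_bounded bU sU.
have := cA_mA_le (W + T) x1; have := cA_mA_le (W - T) x1.
have CS y : normc (ipA ip A y x) ^+ 2 <= normA ip A y ^+ 2.
  rewrite ler_sqr ?nnegrE ?normc_ge0 ?seminorm_ge0 //.
  by rewrite (le_trans (psd_CS ipAP _ _)) // -!normA_seminorm x1 mulr1.
have := CS (W x + T x); have := CS (W x - T x).
have -> : normc (ipA ip A (W x - T x) x) ^+ 2 =
  2 * normA ip A (T x) ^+ 4
  + 2 * normc (ipA ip A (T x) x) ^+ 2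
  - normc (ipA ip A (W x + T x) x) ^+ 2.
  rewrite (psdBl ipAP) (psdDl ipAP).
  have := normc_parallelogram (ipA ip A (W x) x) (ipA ip A (T x) x).
  have -> : normc (ipA ip A (W x) x) ^+ 2 = normA ip A (T x) ^+ 4.
    rewrite WE (psd_real ipAP) -sqr_seminorm // normc_sqr /= expr0n addr0.
    by rewrite -exprM.
  by move=> <-; ring.
have -> : normA ip A (W x - T x) ^+ 2 = 2 * normA ip A (W x) ^+ 2
    + 2 * normA ip A (T x) ^+ 2 - normA ip A (W x + T x) ^+ 2.
  rewrite !normA_seminorm !sqr_seminorm // -parallelogram //; ring.
have UN : normA ip A (W x) ^+ 2 + normA ip A (T x) ^+ 2 <= opnormA ip A U.
  apply: le_trans (opnormA_ge x1 Ubnd).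
  have -> : normA ip A (W x) ^+ 2 + normA ip A (T x) ^+ 2 =
      rform (ipA ip A) (U x) x.
    rewrite /rform UE (WE x x) !(psd_real ipAP).
    by rewrite !normA_seminorm !sqr_seminorm.
  apply: (le_trans (ler_norm _)); apply: (le_trans (rform_CS ipAP _ _)).
  by rewrite -!normA_seminorm x1 mulr1.
move: UN.
have wx : (W + T) x = W x + T x by [].
have wx' : (W - T) x = W x - T x by [].
lra.
Qed.

End Hilbert.

Theorem theorem2p16 (R : realType) (H : completeNormedModType R[i])
    (ip : {dot H for @Num.conj R[i]}) (hH : hilbert_product ip)
    (A : H -> H) (hA : positive_semidefinite ip A)
    (T : H -> H) (hT : BA ip A T) :
  let W := sqabsA ip A T in
  dwA ip A T ^+ 2 <=
    3 * opnormA ip A (sharpA ip A W \o W + W)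
    - cA ip A (W + T) * mA ip A (W + T)
    - cA ip A (W - T) * mA ip A (W - T).
Proof.
cbv zeta; set W := sqabsA ip A T; set rhs := _ - _ - _.
have key x : normA ip A x = 1 ->
    normc (ipA ip A (T x) x) ^+ 2 + normA ip A (T x) ^+ 4 <= rhs.
  exact: dwA_pointwise.
(* On an empty sphere every supremum and infimum is 0, and so are both sides. *)
have [S0|/set0P[x0 x01]] := eqVneq (sphereA ip A) set0.
  rewrite /rhs /dwA /cA /opnormA S0 !image_set0 sup0 inf0.
  by rewrite !mul0r mulr0 !subr0 expr0n.
(* A point of the sphere makes the right side nonnegative, so it is the square of its [Num.sqrt],
   which bounds [dwA]. *)
have rhs0 : 0 <= rhs.
  apply: le_trans (key _ x01).
  by rewrite addr_ge0 ?exprn_ge0 ?seminorm_ge0 ?normc_ge0.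
pose f x := Num.sqrt (normc (ipA ip A (T x) x) ^+ 2
  + normA ip A (T x) ^+ 4).
have f_ub : ubound [set f x | x in sphereA ip A] (Num.sqrt rhs).
  by move=> _ [x x1 <-]; rewrite /f ler_sqrt // key.
have dw : dwA ip A T <= Num.sqrt rhs by apply: ge_sup f_ub; exists (f x0), x0.
have dw0 : 0 <= dwA ip A T.
  apply: (le_trans (sqrtr_ge0 _ : 0 <= f x0)).
  by apply: ub_le_sup; [exists (Num.sqrt rhs)|exists x0].
by rewrite -(sqr_sqrtr rhs0) ler_sqr ?nnegrE ?sqrtr_ge0.
Qed.
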